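(* Assume $\operatorname{zer}(A+B)\neq\varnothing$, that $\operatorname{dom}(A)$ is bounded, and that $A$ or $B$ is uniformly monotone. Let $(\gamma_n)$ be a monotone decreasing sequence in $\big]0,\frac{\sqrt2-1}{\mu}\big[$ such that $$\sum_n\gamma_n^2<+\infty,\qquad\sum_n\gamma_n=+\infty,\qquad\sum_{n\in\mathbb N}\gamma_n^2\,\mathsf E\big[\|r_n-By_n\|^2\mid\mathcal F_n\big]<+\infty\ \text{a.s.},$$ and let $(x_n)$ be generated by the reflected stochastic forward–backward iteration with these step sizes. Then $(x_n)$ converges strongly almost surely to the unique solution $\bar x$ of $0\in A\bar x+B\bar x$.
   Context: $\mathcal H$ is a separable real Hilbert space; $(\Omega,\mathcal F,\mathsf P)$ a probability space. $A:\mathcal H\to2^{\mathcal H}$ is maximally monotone; $B:\mathcal H\to\mathcal H$ is monotone and $\mu$-Lipschitz continuous ($\mu>0$); $\operatorname{zer}(A+B)=\{x:0\in Ax+Bx\}$; $\operatorname{dom}(A)=\{x:Ax\neq\varnothing\}$. An operator $M$ is uniformly monotone if there is an increasing $\phi:[0,\infty[\to[0,\infty]$ vanishing only at $0$ with $\langle x-y,u-v\rangle\ge\phi(\|x-y\|)$ for all $(x,u),(y,v)\in\operatorname{gra}M$. $J_{\gamma A}=(\mathrm{Id}+\gamma A)^{-1}$. Reflected stochastic forward–backward iteration: $(\gamma_n)_{n\ge-1}$ is a sequence in $]0,+\infty[$, $x_0,x_{-1}$ are square-integrable $\mathcal H$-valued random variables, and for every $n\in\mathbb N$: $y_n=2x_n-x_{n-1}$;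 $r_n$ is an $\mathcal H$-valued random variable with $\mathsf E[r_n\mid\mathcal F_n]=By_n$, where $\mathcal F_n=\sigma(x_0,\dots,x_n)$; and $x_{n+1}=J_{\gamma_nA}(x_n-\gamma_nr_n)$. *)

(* Defs.v *)
From HB Require Import structures.
From mathcomp Require Import all_boot all_order all_algebra.
From mathcomp Require Import all_classical all_reals all_analysis measurable_realfun.
Set Implicit Arguments. Unset Strict Implicit. Unset Printing Implicit Defensive.
Import Order.TTheory GRing.Theory Num.Theory.
Import numFieldNormedType.Exports.
Local Open Scope classical_set_scope.
Local Open Scope ring_scope.

Section Defs.
Variable R : realType.

Definition is_inner_product (H : normedModType R) (ip : H -> H -> R) : Prop :=
  (forall x y, ip x y = ip y x) /\
  (forall (a : R) x y z, ip (a *: x + y) z = a * ip x z + ip y z) /\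
  (forall x, ip x x = `|x| ^+ 2).

Definition separable (H : normedModType R) : Prop :=
  exists u : nat -> H, closure (range u) = setT.

Section Operators.
Variables (H : normedModType R) (ip : H -> H -> R).

Definition monotone_op (M : H -> set H) : Prop :=
  forall x y u v, M x u -> M y v -> 0 <= ip (x - y) (u - v).

Definition maximally_monotone (M : H -> set H) : Prop :=
  monotone_op M /\
  forall x u, (forall y v, M y v -> 0 <= ip (x - y) (u - v)) -> M x u.

Definition uniformly_monotone (M : H -> set H) : Prop :=
  exists phi : R -> \bar R,
    (forall t, 0 <= t -> (0 <= phi t)%E) /\
    (forall s t, 0 <= s -> s <= t -> (phi s <= phi t)%E) /\
    (forall t, 0 <= t -> (phi t = 0%E <-> t = 0)) /\
    (forall x y u v, M x u -> M y v -> (phi (Num.norm (x - y)%R) <= (ip (x - y)%R (u - v)%R)%:E)%E).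

Definition sv (B : H -> H) : H -> set H := fun x => [set B x].

Definition zer (A : H -> set H) (B : H -> H) : set H :=
  [set x | exists a, A x a /\ a + B x = 0].

Definition dom (A : H -> set H) : set H := [set x | A x !=set0].

Definition norm_bounded (S : set H) : Prop :=
  exists M : R, forall x, S x -> `|x| <= M.

(** [resolvent_rel A g z p] : p = J_{gA} z, i.e. z belongs to (Id + gA) p
    (J_{gA} = (Id + gA)^{-1}, single-valued when A is maximally monotone). *)
Definition resolvent_rel (A : H -> set H) (g : R) (z p : H) : Prop :=
  exists a, A p a /\ z = p + g *: a.
End Operators.

Section Probability.
Variables (d : measure_display) (Omega : measurableType d) (P : probability Omega R).
Variables (H : normedModType R) (ip : H -> H -> R).

Definition measurable_wrt (F : set (set Omega)) (X : Omega -> H) : Prop :=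
  forall O : set H, open O -> F (X @^-1` O).

Definition H_rv (X : Omega -> H) : Prop := measurable_wrt measurable X.

Definition ereal_measurable_wrt (F : set (set Omega)) (Z : Omega -> \bar R) :
  Prop := forall A : set (\bar R), measurable A -> F (Z @^-1` A).

Definition natural_filtration (X : nat -> Omega -> H) (n : nat) :
  set (set Omega) :=
  <<s [set E | exists k, (k <= n)%N /\ exists O : set H, open O /\
                                     E = X k @^-1` O] >>.

(** [Z] is (a version of) E[X | F] for an integrable H-valued X
    (characterized weakly, through all scalar products with fixed vectors). *)
Definition is_cond_exp_H (F : set (set Omega)) (X Z : Omega -> H) : Prop :=
  measurable_wrt F Z /\
  P.-integrable setT (fun w => (`|X w|)%:E) /\
  P.-integrable setT (fun w => (`|Z w|)%:E) /\
  forall G, F G -> forall v : H,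
    (\int[P]_(w in G) (ip (X w) v)%:E = \int[P]_(w in G) (ip (Z w) v)%:E)%E.

Definition is_cond_exp_nonneg (F : set (set Omega)) (X Z : Omega -> \bar R) :
  Prop :=
  (forall w, (0 <= Z w)%E) /\ ereal_measurable_wrt F Z /\
  forall G, F G -> (\int[P]_(w in G) X w = \int[P]_(w in G) Z w)%E.

Definition square_integrable (X : Omega -> H) : Prop :=
  H_rv X /\ (\int[P]_w (`|X w| ^+ 2)%:E < +oo)%E.
Definition prev_iter (x : nat -> Omega -> H) (xm1 : Omega -> H) (n : nat) :
  Omega -> H := if n is k.+1 then x k else xm1.

Definition refl_iter (x : nat -> Omega -> H) (xm1 : Omega -> H) (n : nat)
  (w : Omega) : H := 2 *: x n w - prev_iter x xm1 n w.
End Probability.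
End Defs.

(* Main.v *)
Require Import Defs.
From HB Require Import structures.
From mathcomp Require Import all_boot all_order all_algebra.
From mathcomp Require Import all_classical all_reals all_analysis measurable_realfun.
From mathcomp Require Import ring lra.
Import Order.TTheory GRing.Theory Num.Theory.
Import numFieldNormedType.Exports.
Local Open Scope classical_set_scope.
Local Open Scope ring_scope.

(** With [xi_n = r_n - B y_n], monotonicity and Young's inequality give, for the energy
    [V_n = |x_n - xbar|^2 + |x_n - x_(n-1)|^2 / 4] and every [eps > 0], a constant [eta > 0] with
    [(1 + gamma_n eta) V_(n+1) <= V_n + gamma_n eta eps + c gamma_n^2 + 4 gamma_n^2 |xi_n|^2
     - 2 gamma_n <x_n - xbar, xi_n>]:
    as [dom A] is bounded, replacing [y_n] by [x_(n+1)] in [B] costs only [O(gamma_n^2)] and a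
    fraction of the squared increments, and uniform monotonicity supplies the left-hand gain.
    The last term has zero conditional mean.  Stopping when the accumulated conditional noise
    exceeds [C], [E V_n] is arbitrarily small along a subsequence because [sum gamma_n = +oo],
    and from such an index on the maximal inequality for nonnegative almost supermartingales
    bounds the probability that [V] ever exceeds a given level; hence [V_n -> 0] a.s.
    The noise [xi_n] need not be measurable for [F_(n+1)], so one cannot sum
    [gamma_n <x_n - xbar, xi_n>] as a martingale. *)

(** * Inner product calculus and nonexpansiveness of the resolvent *)

Section InnerProduct.
Context {R : realType} {H : normedModType R} {ip : H -> H -> R}.
Hypothesis hip : is_inner_product ip.

Lemma ipC x y : ip x y = ip y x. Proof. by case: hip. Qed.

Lemma ipxx x : ip x x = `|x| ^+ 2. Proof. by case: hip => _ []. Qed.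

Lemma ipDl x y z : ip (x + y) z = ip x z + ip y z.
Proof. by case: hip => _ [h _]; rewrite -[x in LHS]scale1r h mul1r. Qed.

Lemma ip0l z : ip 0 z = 0.
Proof. by apply: (addrI (ip 0 z)); rewrite -ipDl !addr0. Qed.

Lemma ipZl a x z : ip (a *: x) z = a * ip x z.
Proof. by case: hip => _ [h _]; rewrite -[a *: x]addr0 h ip0l addr0. Qed.

Lemma ipNl x z : ip (- x) z = - ip x z.
Proof. by rewrite -scaleN1r ipZl mulN1r. Qed.

Lemma ipBl x y z : ip (x - y) z = ip x z - ip y z.
Proof. by rewrite ipDl ipNl. Qed.

Lemma ipDr x y z : ip z (x + y) = ip z x + ip z y.
Proof. by rewrite ipC ipDl !(ipC _ z). Qed.

Lemma ipZr a x z : ip z (a *: x) = a * ip z x.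
Proof. by rewrite ipC ipZl ipC. Qed.

Lemma ipNr x z : ip z (- x) = - ip z x.
Proof. by rewrite ipC ipNl ipC. Qed.

Lemma ipBr x y z : ip z (x - y) = ip z x - ip z y.
Proof. by rewrite ipDr ipNr. Qed.

Lemma sqr_normD x y : `|x + y| ^+ 2 = `|x| ^+ 2 + 2 * ip x y + `|y| ^+ 2.
Proof. by rewrite -!ipxx ipDl !ipDr (ipC y x); ring. Qed.

Lemma ip_polarization x y : ip x y = (`|x| ^+ 2 + `|y| ^+ 2 - `|x - y| ^+ 2) / 2.
Proof. by rewrite -!ipxx ipBl !ipBr (ipC y x); field. Qed.

Lemma Cauchy_Schwarz x y : `|ip x y| <= `|x| * `|y|.
Proof.
have [->|y0] := eqVneq y 0; first by rewrite ipC ip0l !normr0 mulr0.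
have ny : 0 < `|y| by rewrite normr_gt0.
rewrite -ler_sqr ?nnegrE ?mulr_ge0 // real_normK ?num_real // exprMn.
have := sqr_ge0 (Num.norm (`|y| ^+ 2 *: x - ip x y *: y)).
rewrite -(ipxx (_ - _)) ipBl !ipBr !ipZl !ipZr (ipC y x) !ipxx => h.
rewrite -(ler_pM2l (exprn_gt0 2 ny)); nra.
Qed.

Lemma ip_lower_bound x y : - (`|x| * `|y|) <= ip x y.
Proof. by have := Cauchy_Schwarz x y; rewrite ler_norml => /andP[]. Qed.

(** With [z = p + g *: a], expanding [|z - z'| ^+ 2] leaves [|p - p'| ^+ 2], a square, and a cross
    term that monotonicity of [A] makes nonnegative. *)
Lemma resolvent_nonexpansive {A : H -> set H} (g : R) z z' p p' : monotone_op ip A -> 0 < g ->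
  resolvent_rel A g z p -> resolvent_rel A g z' p' -> `|p - p'| <= `|z - z'|.
Proof.
move=> mA g0 [a [Aa ->]] [a' [Aa' ->]].
rewrite -ler_sqr ?nnegrE // opprD addrACA -scalerBr [leRHS]sqr_normD ipZr -addrA lerDl.
by rewrite addr_ge0 ?sqr_ge0 // !mulr_ge0 ?(ltW g0) //; exact: mA.
Qed.

End InnerProduct.

(** * Uniform monotonicity and the one-step energy inequality *)

Section Energy.
Context {R : realType} {H : normedModType R} {ip : H -> H -> R}.
Hypothesis hip : is_inner_product ip.
Context {A : H -> set H} {B : H -> H} {mu : R}.
Hypothesis hA : monotone_op ip A.
Hypothesis hBmon : monotone_op ip (sv B).
Hypothesis hmu : 0 < mu.
Hypothesis hBlip : forall u v : H, `|B u - B v| <= mu * `|u - v|.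
Hypothesis hunif : uniformly_monotone ip A \/ uniformly_monotone ip (sv B).

Lemma sum_monotone x y u v : A x u -> A y v ->
  0 <= ip (x - y) (u - v) + ip (x - y) (B x - B y).
Proof. by move=> xu yv; apply: addr_ge0; [exact: hA|exact: hBmon]. Qed.

(** The modulus vanishes only at zero, so [phi delta] is positive and, by monotonicity of [phi],
    bounds the pairing at every distance at least [delta]. A real [c] is extracted because [phi] may
    take the value [+oo]. *)
Lemma uniformly_monotone_gap {M : H -> set H} : uniformly_monotone ip M ->
  forall delta : R, 0 < delta -> exists2 c, 0 < c &
  forall x y u v, M x u -> M y v -> delta <= `|x - y| -> c <= ip (x - y) (u - v).
Proof.
move=> [phi [phi0 [phile [phieq phiM]]]] delta d0.
have pd : (0 < phi delta)%E.
  rewrite lt_neqAle phi0 1?ltW // andbT eq_sym; apply/eqP.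
  by move/(phieq _ (ltW d0)) => d0'; rewrite d0' ltxx in d0.
have [c c0 cphi] : exists2 c : R, 0 < c & (c%:E <= phi delta)%E.
  case: (phi delta) pd => [p|_|//]; first by rewrite lte_fin; exists p.
  by exists 1 => //; rewrite leey.
exists c => // x y u v xu yv dxy.
rewrite -lee_fin; apply: (le_trans cphi).
by apply: le_trans (phiM _ _ _ _ xu yv); apply: phile => //; exact: ltW.
Qed.

(** Whichever of [A] and [B] is uniformly monotone supplies [c]; plain monotonicity of the other
    adds a nonnegative term. *)
Lemma sum_uniformly_monotone_gap (delta : R) : 0 < delta -> exists2 c, 0 < c &
  forall x y u v, A x u -> A y v -> delta <= `|x - y| ->
  c <= ip (x - y) (u - v) + ip (x - y) (B x - B y).
Proof.
move=> d0; case: hunif => /uniformly_monotone_gap/(_ _ d0)[c c0 h]; exists c => //.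
  move=> x y u v xu yv dxy; rewrite -[c]addr0; apply: lerD; first exact: h.
  exact: hBmon.
move=> x y u v xu yv dxy; rewrite -[c]add0r; apply: lerD; last exact: h.
exact: hA.
Qed.

(** At two zeros the selections of [A] are [- B x] and [- B y], so the pairing for the sum vanishes,
    against the gap at [delta = |x - y|]. *)
Lemma zer_unique x y : zer A B x -> zer A B y -> x = y.
Proof.
move=> [a [Aa /eqP ea]] [b [Ab /eqP eb]].
apply/eqP; rewrite -subr_eq0 -normr_le0 leNgt; apply/negP => /sum_uniformly_monotone_gap[c c0].
move=> /(_ _ _ _ _ Aa Ab (lexx _)); rewrite -(ipDr hip).
rewrite addr_eq0 in ea; rewrite addr_eq0 in eb.
rewrite (eqP ea) (eqP eb) -opprD addNr (ipC hip) (ip0l hip).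
by rewrite leNgt c0.
Qed.

(* The noise term is split along [x1 - xb = (x1 - x) + (x - xb)]: the first part is
   absorbed by [`|x1 - x| ^+ 2], the second has zero conditional mean. *)
Lemma energy_decrease (xb : H) (K g0 : R) : zer A B xb -> 0 < K -> 0 < g0 ->
  forall eps : R, 0 < eps -> exists2 eta, 0 < eta &
  forall (g : R) (xp x x1 r : H), 0 < g <= g0 -> `|x1 - xb| <= K ->
  resolvent_rel A g (x - g *: r) x1 ->
  forall xi, xi = r - B (2 *: x - xp) ->
  (1 + g * eta) * (`|x1 - xb| ^+ 2 + `|x1 - x| ^+ 2 / 4) <=
  `|x - xb| ^+ 2 + `|x - xp| ^+ 2 / 4 + g * eta * eps
  + 8 * K ^+ 2 * mu ^+ 2 * g ^+ 2 + 4 * g ^+ 2 * `|xi| ^+ 2 - 2 * g * ip (x - xb) xi.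
Proof.
move=> [ab [Aab eab]] K0 g00 eps eps0.
have s0 : 0 < Num.sqrt eps by rewrite sqrtr_gt0.
have [c c0 hc] := sum_uniformly_monotone_gap _ s0.
(* The first bound lets the gap [2 * c] pay for [eta * |x1 - xb| ^+ 2]; the second gives
   [g * eta <= 1], so that a quarter of the squared increment pays for its own gain. *)
exists (Num.min (2 * c / K ^+ 2) g0^-1).
  by rewrite lt_min invr_gt0 g00 divr_gt0 ?mulr_gt0 ?exprn_gt0.
set eta := Num.min _ _.
have eta0 : 0 < eta by rewrite lt_min invr_gt0 g00 divr_gt0 ?mulr_gt0 ?exprn_gt0.
have eta1 : eta * K ^+ 2 <= 2 * c.
  by rewrite -ler_pdivlMr ?exprn_gt0 // ge_min lexx.
have eta2 : eta * g0 <= 1 by rewrite -ler_pdivlMr // div1r ge_min lexx orbT.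
move=> g xp x x1 r /andP[gpos gg0] xK [a [Aa eqa]] xi xiE.
pose Q := ip (x1 - xb) (a - ab) + ip (x1 - xb) (B x1 - B xb).
have Q0 : 0 <= Q by exact: sum_monotone.
have Qc : Num.sqrt eps <= `|x1 - xb| -> c <= Q by exact: hc.
(* The resolvent relation reads [x - x1 = g *: (a + r)]; inserting [ab + B xb = 0] exhibits the
   terms of [Q], the Lipschitz error of [B] and the noise. *)
have dxx : x - x1 = g *: ((a - ab) + (B x1 - B xb) + (B (2 *: x - xp) - B x1) + xi).
  have cancel (u v w : H) : (u + v) + (w - v) = u + w by rewrite addrACA subrr addr0.
  have -> : ab = - B xb by apply/eqP; rewrite -addr_eq0; apply/eqP.
  rewrite xiE opprK -(addrA (a + _)) (addrC (B x1 - _)) subrKA cancel cancel.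
  by rewrite scalerDr -[x in LHS](subrK (g *: r)) eqa addrAC [x1 + _]addrC addrK.
have lip : `|B (2 *: x - xp) - B x1| <= mu * (`|x1 - x| + `|x - xp|).
  apply: (le_trans (hBlip _ _)); rewrite ler_pM2l //.
  have -> : 2 *: x - xp - x1 = (x - x1) + (x - xp).
    by rewrite scaler_nat mulr2n addrACA -opprD (addrC x1) opprD addrA.
  by rewrite (le_trans (ler_normD _ _)) // distrC.
have E1 : `|x - xb| ^+ 2 = `|x1 - xb| ^+ 2 + 2 * g * (Q + ip (x1 - xb) (B (2 *: x - xp) - B x1)
   + (ip (x1 - x) xi + ip (x - xb) xi)) + `|x1 - x| ^+ 2.
  have xE : x - xb = (x1 - xb) + (x - x1) by rewrite [RHS]addrC subrKA.
  rewrite [in LHS]xE (sqr_normD hip) (distrC x x1) -(ipDl hip (x1 - x)) subrKA.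
  by rewrite dxx (ipZr hip) /Q !(ipDr hip); ring.
have cs1 := ip_lower_bound hip (x1 - xb) (B (2 *: x - xp) - B x1).
have cs2 := ip_lower_bound hip (x1 - x) xi.
have t0 := normr_ge0 (x1 - xb); have n0 := normr_ge0 (x - xb).
move: E1 cs1 cs2 lip Q0 Qc xK (normr_ge0 (x1 - x)) (normr_ge0 (x - xp)) (normr_ge0 xi) t0 n0.
move: (normr_ge0 (B (2 *: x - xp) - B x1)).
move: (ip (x1 - xb) _) (ip (x1 - x) xi) (ip (x - xb) xi) => p q w.
move: `|x1 - xb| `|x1 - x| `|x - xp| `|x - xb| `|xi| `|B _ - _| Q => t s s' n X L Q.
move=> L0 E1 cs1 cs2 lip Q0 Qc xK s0' s'0 X0 t0 n0.
have hp : - (K * mu * (s + s')) <= p.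
  apply: le_trans cs1; rewrite lerN2 -mulrA.
  by apply: ler_pM.
(* If [t] is at least [sqrt eps], the gap [c <= Q] covers [eta * t ^+ 2]; otherwise [t ^+ 2 < eps]
   and the [eps] term does. *)
have hD : g * eta * (t ^+ 2 + s ^+ 2 / 4 - eps) <= s ^+ 2 / 4 + 2 * g * Q.
  have geta : g * eta <= 1 by apply: le_trans eta2; rewrite mulrC ler_pM2l.
  have geta0 : 0 < g * eta by exact: mulr_gt0.
  have h1 : g * eta * (s ^+ 2 / 4) <= s ^+ 2 / 4.
    by rewrite -[leRHS]mul1r ler_wpM2r // divr_ge0 // sqr_ge0.
  suff h2 : g * eta * (t ^+ 2 - eps) <= 2 * g * Q by lra.
  rewrite -mulrA (mulrC 2) -mulrA ler_pM2l //.
  have [lst|ltt] := leP (Num.sqrt eps) t.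
    have {}Qc := Qc lst.
    have : eta * t ^+ 2 <= eta * K ^+ 2 by rewrite ler_pM2l // lerXn2r ?nnegrE // ltW.
    nra.
  have : t ^+ 2 < eps.
    by rewrite -(sqr_sqrtr (ltW eps0)) ltrXn2r ?nnegrE // ltW.
  nra.
(* Young's inequality for the two Lipschitz errors and the noise. The [s ^+ 2] of [E1] is spent in
   four quarters: on the new energy, [hD], [y1] and [y3]; the [s' ^+ 2 / 4] of the old energy pays
   for [y2]. *)
have y1 := sqr_ge0 (s / 2 - 2 * g * K * mu).
have y2 := sqr_ge0 (s' / 2 - 2 * g * K * mu).
have y3 := sqr_ge0 (s / 2 - 2 * g * X).
have hp' : - (2 * g * (K * mu * (s + s'))) <= 2 * g * p by rewrite -mulrN ler_pM2l // mulr_gt0.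
have hq' : - (2 * g * (s * X)) <= 2 * g * q by rewrite -mulrN ler_pM2l // mulr_gt0.
rewrite E1; lra.
Qed.
End Energy.

(** * Measurability of random vectors in a separable space *)

Lemma separable_dense (R : realType) (H : normedModType R) : separable H ->
  exists u : nat -> H, forall x (e : R), 0 < e -> exists i, `|x - u i| < e.
Proof.
move=> [u hu]; exists u => x e e0.
have : closure (range u) x by rewrite hu.
move=> /(_ (ball x e) (nbhsx_ballx _ _ e0))[_ [[i _ <-]]].
by rewrite -ball_normE; exists i.
Qed.

Section RandomVectors.
Context {R : realType} {H : normedModType R} {d : measure_display} {T : measurableType d}.
Implicit Types f g z : T -> H.

Lemma H_rv_continuous f (h : H -> R) : H_rv f -> continuous h ->
  measurable_fun setT (h \o f).
Proof.
move=> mf /continuousP ch; apply: (measurability _ (RGenOpens.measurableE R)).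
move=> _ [_ [a [b ->] <-]]; rewrite setTI comp_preimage; apply: mf; apply: ch.
exact: interval_open.
Qed.

Lemma H_rv_comp f (h : H -> H) : H_rv f -> continuous h -> H_rv (h \o f).
Proof. by move=> mf /continuousP ch O oO; exact: mf (ch _ oO). Qed.

(** Carries measurability through the resolvent relation, where [x] is not given as a function
    composed with [z]. *)
Lemma H_rv_lipschitz z (x : T -> H) : H_rv z ->
  (forall w w', `|x w - x w'| <= `|z w - z w'|) -> H_rv x.
Proof.
move=> mz xz O oO.
(* an open set of the whole space with [z @^-1` O' = x @^-1` O], so that the Lipschitz
   map [z w |-> x w] need not be extended beyond the range of [z] *)
pose O' := \bigcup_(p in [set p : T * R | ball (x p.1) p.2 `<=` O]) ball (z p.1) p.2.
have -> : x @^-1` O = z @^-1` O'.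
  apply/seteqP; split => [w xO|w [[w0 e] /= bO zb]].
    have /nbhs_ballP[e /= e0 he] : nbhs (x w) O by exact: open_nbhs_nbhs.
    by exists (w, e) => //=; exact: ballxx.
  by apply: bO; move: zb; rewrite -!ball_normE /=; apply: le_lt_trans.
by apply: mz; apply: bigcup_open => p _; exact: ball_open.
Qed.

Hypothesis hsep : separable H.

(** By density [|f w - g w|] is the supremum over [i] of [|f w - u i| - |g w - u i|], approached as
    [u i] tends to [g w]; only real functions of one vector each are involved. *)
Lemma measurable_dist f g : H_rv f -> H_rv g ->
  measurable_fun setT (fun w => `|f w - g w|).
Proof.
move=> mf mg; have [u hu] := separable_dense _ _ hsep.
have cdist (v : H) : continuous (fun y : H => `|y - v|).
  by move=> y; apply: cvg_norm; apply: cvgB; [exact: cvg_id|exact: cvg_cst].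
pose h i w := `|f w - u i| - `|g w - u i|.
have hle i w : h i w <= `|f w - g w|.
  by rewrite lerBlDr (le_trans _ (ler_normD _ _)) // subrKA.
have -> : (fun w => `|f w - g w|) = (fun w => sups (h ^~ w) 0%N).
  apply/funext => w; rewrite /sups; apply/eqP; rewrite eq_le; apply/andP; split.
    apply/ler_addgt0Pr => e e0; have [i hi] := hu (g w) (e / 2) (divr_gt0 e0 (ltr0n _ 2)).
    have le1 : h i w <= sup (sdrop (h ^~ w) 0%N).
      apply: ub_le_sup; last by exists i.
      by exists `|f w - g w| => _ [k _ <-]; exact: hle.
    have : `|f w - g w| <= `|f w - u i| + `|g w - u i|.
      by rewrite (distrC (g w)) (le_trans _ (ler_normD _ _)) // subrKA.
    have : h i w = `|f w - u i| - `|g w - u i| by [].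
    rewrite /=; lra.
  apply: ge_sup; first by exists (h 0%N w); exists 0%N.
  by move=> _ [k _ <-]; exact: hle.
apply: measurable_fun_sups => [w _|i].
  by exists `|f w - g w| => _ [k _ <-]; exact: hle.
by apply: measurable_funB; [exact: (H_rv_continuous _ (fun y => `|y - u i|))|exact: (H_rv_continuous _ (fun y => `|y - u i|))].
Qed.

(** Separability makes every open set a countable union of balls centred at the [u i] with radii
    [1 / (k + 1)]. *)
Lemma H_rv_dist f :
  (forall v, measurable_fun setT (fun w => `|f w - v|)) -> H_rv f.
Proof.
move=> mf O oO; have [u hu] := separable_dense _ _ hsep.
have -> : f @^-1` O = \bigcup_(p in [set p : nat * nat | ball (u p.1) p.2.+1%:R^-1 `<=` O])
    [set w | `|f w - u p.1| < p.2.+1%:R^-1].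
  apply/seteqP; split => [w fO|w [[i k] /= bO fb]]; last first.
    by apply: bO; rewrite -ball_normE /= distrC.
  have /nbhs_ballP[e /= e0 he] : nbhs (f w) O by exact: open_nbhs_nbhs.
  have [k hk] : exists k : nat, k.+1%:R^-1 < e / 2.
    exists (Num.bound (e / 2)^-1); rewrite invf_plt ?posrE ?divr_gt0 //.
    apply: lt_trans (archi_boundP _) _; first by rewrite invr_ge0 ltW // divr_gt0.
    by rewrite ltr_nat.
  have k0 : 0 < k.+1%:R^-1 :> R by rewrite invr_gt0 ltr0n.
  have [i hi] := hu (f w) _ k0; exists (i, k) => //= y; rewrite -ball_normE /= => uy.
  apply: he; rewrite -ball_normE /=.
  have : `|f w - y| <= `|f w - u i| + `|u i - y|.
    by rewrite (le_trans _ (ler_normD _ _)) // subrKA.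
  by move: (_^-1) hk hi uy => q *; lra.
rewrite bigcup_mkcond; apply: countable_bigcupT_measurable => [|p]; first exact: countableP.
case: ifP => // _; rewrite -[X in measurable X]setTI.
have mE : measurable_fun setT (fun w => (`|f w - u p.1|)%:E) by apply/measurable_EFinP.
exact: (emeasurable_fun_infty_o measurableT mE (p.2.+1%:R^-1)%:E).
Qed.

Lemma H_rv_sub f g : H_rv f -> H_rv g -> H_rv (fun w => f w - g w).
Proof.
move=> mf mg; apply: H_rv_dist => v.
under eq_fun do rewrite -addrA -opprD.
apply: measurable_dist => //; apply: (H_rv_comp g (fun y => y + v)) => // y.
by apply: cvgD; [exact: cvg_id|exact: cvg_cst].
Qed.

Lemma H_rv_scale (k : R) f : H_rv f -> H_rv (fun w => k *: f w).
Proof.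
move=> mf; apply: (H_rv_comp f (fun y => k *: y)) => // y.
exact: scaler_continuous.
Qed.

Lemma H_rv_cst (v : H) : H_rv (fun _ : T => v).
Proof.
move=> O oO; have [vO|nvO] := pselect (O v).
  by rewrite (_ : _ @^-1` _ = setT) //; apply/seteqP; split.
by rewrite (_ : _ @^-1` _ = set0) //; apply/seteqP; split.
Qed.

Lemma measurable_norm f : H_rv f -> measurable_fun setT (fun w => `|f w|).
Proof. by move=> mf; apply: (H_rv_continuous _ Num.norm) => //; exact: norm_continuous. Qed.

Lemma measurable_ip (ip : H -> H -> R) f g : is_inner_product ip -> H_rv f -> H_rv g ->
  measurable_fun setT (fun w => ip (f w) (g w)).
Proof.
move=> hip mf mg; under eq_fun do rewrite (ip_polarization hip).
apply: measurable_funM => //; apply: measurable_funB.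
  by apply: measurable_funD; apply: measurable_funX; exact: measurable_norm.
by apply: measurable_funX; apply: measurable_dist.
Qed.

Lemma H_rv_lipschitz_comp (B : H -> H) (mu : R) f : 0 < mu ->
  (forall u v, `|B u - B v| <= mu * `|u - v|) -> H_rv f -> H_rv (B \o f).
Proof.
move=> mu0 hB mf; apply: H_rv_lipschitz (H_rv_scale mu f mf) _ => w w'.
by rewrite -scalerBr normrZ gtr0_norm //; exact: hB.
Qed.

End RandomVectors.

(** * Elementary facts on real sequences *)

(** The factor [s] drops out: [p' <= eps] settles the claim at once, and otherwise [s * p'] exceeds
    [s * eps]. *)
Lemma le_scaled_sum_eps (R : realFieldType) (s p p' q eps : R) : 0 <= s -> 0 < eps ->
  0 <= p -> 0 <= q -> (1 + s) * p' <= p + s * eps + q -> p' <= p + q + eps.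
Proof. move=> s0 eps0 p0 q0; have [|] := lerP p' eps; nra. Qed.

(** Telescoping would keep [c] times the partial sums of [g] bounded. *)
Lemma descent_contradiction (R : realType) (g a b : nat -> R) (m : nat) (c C : R) :
  0 < c -> (forall k, 0 <= a k) -> (forall k, 0 <= b k) -> (forall k, 0 <= g k) ->
  (forall N, \sum_(k < N) b k <= C) ->
  (forall M, exists N, M <= \sum_(k < N) g k) ->
  ~ (forall k, (m <= k)%N -> a k.+1 + g k * c <= a k + b k).
Proof.
move=> c0 a0 b0 g0 bC gdiv h.
have key i : a (m + i)%N + c * \sum_(k < m + i) g k <= a m + c * \sum_(k < m) g k + \sum_(k < m + i) b k.
  elim: i => [|i ih]; first by rewrite addn0 lerDl sumr_ge0.
  by rewrite addnS !big_ord_recr /=; have := h (m + i)%N (leq_addr _ _); lra.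
have [N hN] := gdiv ((a m + c * \sum_(k < m) g k + C + 1) / c).
have := key N; have := bC (m + N)%N; have := a0 (m + N)%N.
have : \sum_(k < N) g k <= \sum_(k < m + N) g k.
  elim: (m) => [//|n ih]; rewrite addSn big_ord_recr /=.
  by apply: le_trans ih _; rewrite lerDl.
rewrite ler_pdivrMr // in hN; nra.
Qed.

(** [m0] is an index whose partial sum is within [eps] of the supremum of all partial sums. *)
Lemma sum_tail_small (R : realType) (b : nat -> R) (C : R) :
  (forall k, 0 <= b k) -> (forall N, \sum_(k < N) b k <= C) ->
  forall eps, 0 < eps -> exists m0, forall m i, (m0 <= m)%N -> \sum_(k < i) b (m + k)%N <= eps.
Proof.
move=> b0 bC eps eps0; pose s N := \sum_(k < N) b k.
have sC : has_sup (range s).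
  by split; [exists (s 0%N); exists 0%N|exists C => _ [N _ <-]; exact: bC].
have [_ [m0 _ <-] hm0] := sup_adherent eps0 sC; exists m0 => m i m0m.
have smi : s (m + i)%N = s m + \sum_(k < i) b (m + k)%N.
  elim: i => [|i ih]; first by rewrite addn0 big_ord0 addr0.
  by rewrite addnS /s !big_ord_recr /= -/(s _) ih addrA.
have : s (m + i)%N <= sup (range s) by apply: sup_upper_bound => //; exists (m + i)%N.
have : s m0 <= s m.
  rewrite -(subnKC m0m); elim: (m - m0)%N => [|j ih]; first by rewrite addn0.
  by rewrite addnS; apply: le_trans ih _; rewrite [leRHS]big_ord_recr lerDl.
lra.
Qed.

(** * Generated sub-sigma-algebras *)

Section SubSigma.
Context {d : measure_display} {T : measurableType d} {S : set (set T)}.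
Hypothesis Sm : S `<=` measurable.

Lemma sub_measurable (E : set T) : <<s S >> E -> measurable E.
Proof. by apply: smallest_sub => //; exact: sigma_algebra_measurable. Qed.

Lemma sub_measurable_fun d' (U : measurableType d') (f : T -> U) :
  measurable_fun setT (f : g_sigma_algebraType S -> U) -> measurable_fun setT f.
Proof. by move=> mf _ Y mY; apply: sub_measurable; exact: mf. Qed.

End SubSigma.

(** * Nonnegative almost supermartingales: maximal inequality and almost sure convergence to zero *)

Section AlmostSupermartingale.
Local Open Scope ereal_scope.
Context {R : realType} {d : measure_display} {T : measurableType d}.
Variable P : probability T R.
Variable S : nat -> set (set T).
Hypothesis Sm : forall n, S n `<=` measurable.
Hypothesis SS : forall n, S n `<=` S n.+1.
Variables (V : nat -> T -> R) (b : nat -> T -> \bar R) (g : nat -> R) (K : R).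
Hypothesis V0 : forall n w, (0 <= V n w)%R.
Hypothesis VK : forall n w, (V n w <= K)%R.
Hypothesis FV : forall n, measurable_fun setT (V n : g_sigma_algebraType (S n) -> R).
Hypothesis b0 : forall n w, 0 <= b n w.
Hypothesis Fb : forall n, measurable_fun setT (b n : g_sigma_algebraType (S n) -> \bar R).
Hypothesis g0 : forall n, (0 <= g n)%R.
Hypothesis gdiv : forall M : R, exists N, (M <= \sum_(k < N) g k)%R.
(** The conditional drift inequality, tested on events of the filtration instead of being stated
    with conditional expectations of [V]. *)
Hypothesis step : forall eps : R, (0 < eps)%R -> exists2 eta : R, (0 < eta)%R &
  forall n G, <<s S n >> G ->
  (1 + g n * eta)%:E * \int[P]_(w in G) (V n.+1 w)%:E <=
  \int[P]_(w in G) (V n w)%:E + (g n * eta * eps)%:E + \int[P]_(w in G) b n w.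

Let F n := <<s S n >>.

Let Fm n E : F n E -> measurable E.
Proof. exact: sub_measurable. Qed.

Let FS n : F n `<=` F n.+1.
Proof. by apply: sub_sigma_algebra2; exact: SS. Qed.

Let Fle m n : (m <= n)%N -> F m `<=` F n.
Proof.
elim: n => [|n ih]; first by rewrite leqn0 => /eqP ->.
by rewrite leq_eqVlt ltnS => /orP[/eqP->//|/ih h]; exact: subset_trans (@FS n).
Qed.

Let FI n E1 E2 : F n E1 -> F n E2 -> F n (E1 `&` E2).
Proof. exact: (@measurableI _ (g_sigma_algebraType (S n))). Qed.

Let FC n E : F n E -> F n (~` E).
Proof. exact: (@measurableC _ (g_sigma_algebraType (S n))). Qed.

Let mV n : measurable_fun setT (V n).
Proof. by apply: sub_measurable_fun (FV n). Qed.

Let mVE n : measurable_fun setT (fun w => (V n w)%:E).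
Proof. by apply/measurable_EFinP. Qed.

Let mb n : measurable_fun setT (b n).
Proof. by apply: sub_measurable_fun (Fb n). Qed.

Let V0E n w : 0 <= (V n w)%:E. Proof. by rewrite lee_fin. Qed.

Let iV0 n G : 0 <= \int[P]_(w in G) (V n w)%:E.
Proof. by apply: integral_ge0. Qed.

Let ib0 n G : 0 <= \int[P]_(w in G) b n w.
Proof. by apply: integral_ge0 => w _. Qed.

Let iVfin n G : measurable G -> \int[P]_(w in G) (V n w)%:E \is a fin_num.
Proof.
move=> mG; rewrite ge0_fin_numE //.
apply: (@le_lt_trans _ _ (\int[P]_(w in G) (cst K%:E w))).
  by apply: ge0_le_integral => //; try exact: measurable_funTS; move=> w _; rewrite lee_fin.
rewrite integral_cst // (le_lt_trans (y := `|K|%:E)) ?ltry //.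
apply: (@le_trans _ _ (`|K|%:E * P G)).
  by rewrite lee_wpmul2r // lee_fin ler_norm.
by rewrite -[leRHS]mule1 lee_wpmul2l // probability_le1.
Qed.

(** Let [eps] tend to zero: [eta] varies with [eps], but [le_scaled_sum_eps] gives a bound free of
    [eta]. *)
Lemma almost_supermartingale_le n G : <<s S n >> G ->
  \int[P]_(w in G) (V n.+1 w)%:E <= \int[P]_(w in G) (V n w)%:E + \int[P]_(w in G) b n w.
Proof.
move=> FG; have mG := Fm _ _ FG; apply/lee_addgt0Pr => eps eps0.
have [eta eta0 /(_ n _ FG)] := step _ eps0.
have := ib0 n G; have := iV0 n G.
rewrite -(fineK (iVfin n _ mG)) -(fineK (iVfin n.+1 _ mG)).
case: (\int[P]_(w in G) b n w) => [q||] //.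
- rewrite -!EFinM -!EFinD !lee_fin => p0 q0.
  by apply: le_scaled_sum_eps => //; rewrite mulr_ge0 // ltW.
- by rewrite -EFinD [X in _ -> _ <= X](_ : _ = +oo) ?leey.
Qed.

Section Localized.
Variable C : R.
Hypothesis C0 : (0 <= C)%R.

(** Stopping event: the noise accumulated through time [n] is at most [C]. As [b k] is known at time
    [k], it belongs to [F n], and it shrinks as [n] grows. *)
Let G n : set T := [set w | \sum_(k < n.+1) b k w <= C%:E].

Let FG n : F n (G n).
Proof.
have mF : measurable_fun setT ((fun w => \sum_(k < n.+1) b k w) : g_sigma_algebraType (S n) -> \bar R).
  apply: emeasurable_sum => k _ Y mY.
  by apply: (Fle k n); [rewrite -ltnS|exact: Fb].
rewrite -[G n]setTI.
exact: (@emeasurable_fun_infty_c _ (g_sigma_algebraType (S n)) _ _ _ measurableT mF).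
Qed.

Let mG n : measurable (G n). Proof. exact: Fm (FG n). Qed.

Let GS n : G n.+1 `<=` G n.
Proof.
move=> w; rewrite /G /= big_ord_recr /=; apply: le_trans.
by rewrite leeDl.
Qed.

Let bb n := fine (\int[P]_(w in G n) b n w).

(** If [w] lies in [G N], the full sum through [N] is at most [C]; otherwise the new term is
    zero. *)
Let sum_bG N w : \sum_(k < N) (b k \_ (G k)) w <= C%:E.
Proof.
elim: N => [|N ih]; first by rewrite big_ord0 lee_fin.
rewrite big_ord_recr /= patchE; case: ifPn => [/set_mem wG|_]; last by rewrite adde0.
apply: le_trans wG; rewrite big_ord_recr /= leeD2r //.
by apply: lee_sum => k _; rewrite patchE; case: ifP.
Qed.

Let sum_ib N : \sum_(k < N) \int[P]_(w in G k) b k w <= C%:E.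
Proof.
under eq_bigr do rewrite integral_mkcond.
rewrite -ge0_integral_sum //; last 2 first.
- by move=> k; apply/(measurable_restrictT _ (mG k)); exact: measurable_funTS.
- by move=> k w _; rewrite patchE; case: ifP.
apply: (@le_trans _ _ (\int[P]_w cst C%:E w)).
  apply: ge0_le_integral => //.
  - by move=> w _; apply: sume_ge0 => k _; rewrite patchE; case: ifP.
  - apply: emeasurable_sum => k; apply/(measurable_restrictT _ (mG k)).
    exact: measurable_funTS.
by rewrite integral_cst // [X in _ * X]probability_setT mule1.
Qed.

Let bbE n : \int[P]_(w in G n) b n w = (bb n)%:E.
Proof.
rewrite /bb fineK // ge0_fin_numE //.
apply: le_lt_trans (ltry C); apply: le_trans (sum_ib n.+1).
by rewrite big_ord_recr /= leeDr // sume_ge0.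
Qed.

Let bb0 n : (0 <= bb n)%R. Proof. by rewrite fine_ge0. Qed.

Let sum_bb N : (\sum_(k < N) bb k <= C)%R.
Proof. by rewrite -lee_fin -sumEFin; under eq_bigr do rewrite -bbE; exact: sum_ib. Qed.

Let a n := fine (\int[P]_(w in G n) (V n w)%:E).

Let aE n : \int[P]_(w in G n) (V n w)%:E = (a n)%:E.
Proof. by rewrite /a fineK // iVfin. Qed.

Let a0 n : (0 <= a n)%R. Proof. by rewrite fine_ge0. Qed.

(** Were [a k >= 2 * eps] from [m] on, the gain, at least [2 * g k * eta * eps], would beat the
    error by [g k * eta * eps] at every step, which the divergence of the sums of [g] forbids. *)
Let a_small (eps : R) m : (0 < eps)%R -> exists2 k, (m <= k)%N & (a k < 2 * eps)%R.
Proof.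
move=> eps0; apply: contrapT => nk.
have ak k : (m <= k)%N -> (2 * eps <= a k)%R.
  by move=> mk; rewrite leNgt; apply/negP => ?; apply: nk; exists k.
have [eta eta0 hstep] := step _ eps0.
apply: (@descent_contradiction R g a bb m (eta * eps) C) => //; first exact: mulr_gt0.
move=> k mk; have := hstep _ _ (FG k).
rewrite aE bbE -(fineK (iVfin k.+1 _ (mG k))) -EFinM -!EFinD lee_fin.
have : (a k.+1 <= fine (\int[P]_(w in G k) (V k.+1 w)%:E))%R.
  rewrite -lee_fin -aE fineK ?iVfin //.
  by apply: ge0_subset_integral => //; exact: measurable_funTS.
move: (fine _) (ak _ (leqW mk)) => v; have := mulr_ge0 (g0 k) (ltW eta0); nra.
Qed.

Let F_lt n (l : R) : F n [set w | (V n w < l)%R].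
Proof.
have mF : measurable_fun setT ((fun w => (V n w)%:E) : g_sigma_algebraType (S n) -> \bar R).
  by apply/measurable_EFinP; exact: FV.
rewrite -[X in F n X]setTI.
exact: (@emeasurable_fun_infty_o _ (g_sigma_algebraType (S n)) _ _ _ measurableT mF l%:E).
Qed.

Let m_lt n (l : R) : measurable [set w | (V n w < l)%R].
Proof. exact: Fm (F_lt n l). Qed.

(** Markov's inequality on the part [E2] where the level is reached, keeping the integral over the
    disjoint part [E1]. *)
Let split_level n (l : R) E E1 E2 : measurable E -> measurable E1 -> measurable E2 ->
  E1 `<=` E `&` [set w | (V n w < l)%R] -> E2 `<=` E `\` [set w | (V n w < l)%R] ->
  (0 <= l)%R ->
  \int[P]_(w in E1) (V n w)%:E + l%:E * P E2 <= \int[P]_(w in E) (V n w)%:E.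
Proof.
move=> mE mE1 mE2 E1E E2E l0.
have dE : [disjoint E1 & E2].
  by apply/disj_setPS => w [/E1E[_ Vl] /E2E[_]].
rewrite -integral_cst //.
apply: (@le_trans _ _ (\int[P]_(w in E1) (V n w)%:E + \int[P]_(w in E2) (V n w)%:E)).
  rewrite leeD2l //; apply: ge0_le_integral => //.
  - exact: measurable_funTS.
  - by move=> w /E2E[_ /negP]; rewrite -leNgt lee_fin.
rewrite -ge0_integral_setU //; last exact: measurable_funTS.
apply: ge0_subset_integral => //; first exact: measurableU.
  exact: measurable_funTS.
by move=> w [/E1E[]|/E2E[]].
Qed.

Section Maximal.
Variables (l : R) (m : nat).
Hypothesis l0 : (0 <= l)%R.

Let below n : set T := [set w | forall j, (m <= j <= n)%N -> (V j w < l)%R].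

Let F_below n : F n (below n).
Proof.
have -> : below n = \bigcap_(j in [set j | m <= j <= n]%N) [set w | (V j w < l)%R] by [].
apply: (@bigcap_measurableType _ (g_sigma_algebraType (S n))) => j /andP[_ jn].
by apply: (Fle j n) => //; exact: F_lt.
Qed.

(** Doob's argument: paths still below [l] carry their integral, paths that have crossed carry mass
    [l], and the step from time [n] raises this total by at most [bb n]. *)
Let maximal i : 
  \int[P]_(w in G (m + i) `&` below (m + i)) (V (m + i) w)%:E +
  l%:E * P (G (m + i) `\` below (m + i)) <= (a m + \sum_(k < i) bb (m + k))%:E.
Proof.
have mH n : measurable (G n `&` below n) by apply: (Fm n); exact: FI.
have mQ n : measurable (G n `\` below n) by apply: (Fm n); apply: FI => //; exact: FC.
elim: i => [|i ih].
  rewrite big_ord0 addr0 addn0 -aE; apply: split_level => //.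
    by move=> w [Gw bw]; split=> //; apply: bw; rewrite leqnn.
  move=> w [Gw nb]; split=> // Vl; apply: nb => j.
  by rewrite -eqn_leq => /eqP <-.
set n := (m + i)%N in ih *; rewrite addnS -/n.
rewrite big_ord_recr /= addrA EFinD.
apply: le_trans (leeD2r _ ih); rewrite [leRHS]addeAC -(bbE n).
(* Paths of [G n.+1] whose first crossing after [m] happens exactly at time [n.+1]. *)
set E2 := (G n.+1 `&` below n) `\` [set w | (V n.+1 w < l)%R].
have mE2 : measurable E2.
  by apply: measurableD => //; apply: (Fm n.+1); apply: FI => //; exact: FS.
apply: (@le_trans _ _ (\int[P]_(w in G n.+1 `&` below n.+1) (V n.+1 w)%:E +
   l%:E * P E2 + l%:E * P (G n `\` below n))).
  rewrite -[leRHS]addeA leeD2l // -ge0_muleDr // lee_wpmul2l //.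
  apply: (@le_trans _ _ (P (E2 `|` (G n `\` below n)))); last exact: measureU2.
  apply: le_measure; rewrite ?inE //; first exact: measurableU.
  move=> w [Gw nb]; have [bw|nbw] := pselect (below n w).
    left; split => // Vl; apply: nb => j /andP[mj].
    by rewrite leq_eqVlt => /orP[/eqP->//|]; rewrite ltnS => jn; apply: bw; rewrite mj.
  by right; split=> //; exact: GS.
rewrite leeD2r //.
apply: (@le_trans _ _ (\int[P]_(w in G n `&` below n) (V n w)%:E + \int[P]_(w in G n `&` below n) b n w)); last first.
  rewrite leeD2l //; apply: ge0_subset_integral => //.
  exact: measurable_funTS.
apply: le_trans (almost_supermartingale_le _ _ _); last exact: FI.
apply: split_level => //.
- move=> w [Gw bw]; split; last by apply: bw; rewrite leqnn andbT /n leqW // leq_addr.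
  by split; [exact: GS|move=> j /andP[mj jn]; apply: bw; rewrite mj leqW].
- by move=> w [[Gw bw] nV]; split => //; split => //; exact: GS.
Qed.

Let mGoo : measurable (\bigcap_n G n). Proof. exact: bigcap_measurable. Qed.

(** The events [Q i] of a crossing by time [m + i] increase to the event of any crossing, and
    [maximal] bounds them uniformly. *)
Lemma maximal_inequality (B : R) : (forall i, \sum_(k < i) bb (m + k) <= B)%R ->
  l%:E * P (\bigcap_n G n `&` [set w | exists2 j, (m <= j)%N & (l <= V j w)%R]) <= (a m + B)%:E.
Proof.
move=> hB.
pose Q i := \bigcap_n G n `\` below (m + i).
have mQ i : measurable (Q i).
  by apply: measurableD => //; exact: Fm (F_below _).
have -> : \bigcap_n G n `&` [set w | exists2 j, (m <= j)%N & (l <= V j w)%R] = \bigcup_i Q i.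
  apply/seteqP; split => w.
    move=> [Gw [j mj lV]]; exists (j - m)%N => //; split => //; rewrite subnKC // => /(_ j).
    by rewrite mj leqnn ltNge lV => /(_ isT).
  move=> [i _ [Gw nb]]; split => //; apply: contrapT => nex; apply: nb => j /andP[mj _].
  by rewrite ltNge; apply/negP => lV; apply: nex; exists j.
have Qnd : {homo Q : i k / (i <= k)%N >-> (i <= k)%O}.
  move=> i k ik; apply/subsetPset => w [Gw nb]; split => // bk; apply: nb => j /andP[mj ji].
  by apply: bk; rewrite mj (leq_trans ji) // leq_add2l.
have cQ := nondecreasing_cvg_mu (mu := P) mQ (bigcup_measurable (fun i _ => mQ i)) Qnd.
rewrite -(cvg_lim _ cQ) //.
have Qle i : l%:E * P (Q i) <= (a m + B)%:E.
  apply: (@le_trans _ _ (a m + \sum_(k < i) bb (m + k))%:E); last by rewrite lee_fin lerD2l.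
  apply: le_trans (maximal i); apply: (@le_trans _ _ (l%:E * P (G (m + i) `\` below (m + i)))).
    rewrite lee_wpmul2l // le_measure // ?inE //; first by apply: (Fm (m + i)); apply: FI => //; exact: FC.
    by move=> w [Gw nb]; split => //; exact: Gw.
  by rewrite leeDr.
rewrite -limeMl //; last by apply/cvg_ex; eexists; exact: cQ.
apply: lime_le; last by apply: nearW => i; exact: Qle.
by apply: is_cvgeMl => //; apply/cvg_ex; eexists; exact: cQ.
Qed.

End Maximal.

(** Restart at a late [m] where both [a m] and the remaining noise are small: infinitely many
    crossings entail one after [m], which [maximal_inequality] makes improbable. *)
Lemma localized_negligible (l : R) : (0 < l)%R ->
  P.-negligible (\bigcap_n G n `&` [set w | forall m, exists2 j, (m <= j)%N & (l <= V j w)%R]).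
Proof.
move=> l0; pose Y m := \bigcap_n G n `&` [set w | exists2 j, (m <= j)%N & (l <= V j w)%R].
have mY m : measurable (Y m).
  apply: measurableI; first exact: bigcap_measurableType.
  have -> : [set w | exists2 j, (m <= j)%N & (l <= V j w)%R] =
      \bigcup_(j in [set j | m <= j]%N) ~` [set w | (V j w < l)%R].
    apply/seteqP; split => [w [j mj lV]|w [j mj /negP lV]]; exists j => //.
      by apply/negP; rewrite -leNgt.
    by rewrite leNgt.
  by apply: bigcup_measurable => j _; apply: measurableC.
exists (\bigcap_m Y m); split; first exact: bigcap_measurableType.
  have mX : measurable (\bigcap_m Y m) by exact: bigcap_measurableType.
  have pf : P (\bigcap_m Y m) \is a fin_num by exact: fin_num_measure.
  apply/eqP; rewrite eq_le measure_ge0 andbT -(fineK pf) lee_fin leNgt; apply/negP => p0.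
  (* With [a m < 2 * e] and noise tail at most [e], the bound [l * p <= a m + e] would give
     [l * p < 3 * e], three quarters of [l * p]. *)
  set p := fine _ in p0; pose e := (l * p / 4)%R.
  have e0 : (0 < e)%R by rewrite divr_gt0 // mulr_gt0.
  have [m0 hm0] := sum_tail_small _ bb C bb0 sum_bb _ e0.
  have [m m0m am] := a_small _ m0 e0.
  have : l%:E * P (\bigcap_m Y m) <= (a m + e)%:E.
    apply: le_trans (maximal_inequality l m (ltW l0) e (fun i => hm0 m i m0m)).
    rewrite lee_wpmul2l ?lee_fin ?(ltW l0) //; apply: le_measure; rewrite ?inE //.
      exact: mY.
    exact: bigcap_inf.
  rewrite -(fineK pf) -EFinM lee_fin -/p; have := mulr_gt0 l0 p0.
  by rewrite /e in am *; lra.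
by move=> w [Gw h] m _; split.
Qed.

End Localized.

(** Almost every path has total noise below some natural [C], hence stays in every stopping event
    for [C]; the null sets over [C] and the levels [1 / (j + 1)] are countably many. *)
Theorem almost_supermartingale_cvg0 :
  {ae P, forall w, \sum_(n <oo) b n w < +oo} ->
  {ae P, forall w, (fun n => V n w) @ \oo --> (0%R : R)}.
Proof.
move=> bfin.
have j0 (j : nat) : (0 < j.+1%:R^-1 :> R)%R by rewrite invr_gt0 ltr0n.
have bad (C j : nat) := localized_negligible C%:R (ler0n _ _) _ (j0 j).
apply: negligibleS (negligibleU bfin (negligible_bigcup (fun C =>
  negligible_bigcup (bad C)))).
move=> w nV; apply: contrapT => /not_orP[/contrapT bw nbad]; apply: nV => /=.
have [C hC] : exists C : nat, \sum_(n <oo) b n w <= C%:R%:E.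
  have s0 : 0 <= \sum_(n <oo) b n w by apply: nneseries_ge0.
  move: bw s0 => /=; case: (\sum_(n <oo) b n w) => [s||] // _ _.
  exists (Num.bound `|s|); rewrite lee_fin; apply: le_trans (ler_norm _) _.
  exact: ltW (archi_boundP (normr_ge0 _)).
apply/cvgr0Pnorm_lt => eps eps0.
have [j hj] : exists j : nat, (j.+1%:R^-1 < eps)%R.
  exists (Num.bound eps^-1); rewrite invf_plt ?posrE //.
  apply: lt_trans (archi_boundP _) _; first by rewrite invr_ge0 ltW.
  by rewrite ltr_nat.
apply: contrapT => nev; apply: nbad; exists C => //; exists j => //; split.
  move=> n _ /=; apply: le_trans hC; rewrite -(big_mkord xpredT (fun k => b k w)).
  exact: nneseries_lim_ge.
move=> m; apply: contrapT => nex; apply: nev; exists m => // k /= mk.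
rewrite ger0_norm //; apply: le_lt_trans hj; rewrite leNgt; apply/negP => Vk.
by apply: nex; exists k => //; exact: ltW.
Qed.

End AlmostSupermartingale.

(** * Pairing the noise with bounded adapted vectors *)

Section Orthogonality.
Context {R : realType} {H : normedModType R} {ip : H -> H -> R}.
Hypothesis hip : is_inner_product ip.
Hypothesis hsep : separable H.
Context {d : measure_display} {T : measurableType d}.
Variable P : probability T R.

Lemma integrable_ip (U D : T -> H) (K : R) : H_rv U -> H_rv D -> (forall w, `|U w| <= K) ->
  P.-integrable setT (fun w => (`|D w|)%:E) ->
  P.-integrable setT (fun w => (ip (U w) (D w))%:E).
Proof.
move=> mU mD UK iD.
have iKD : P.-integrable setT (fun w => K%:E * (`|D w|)%:E)%E.
  by apply: integrableZl.
apply: le_integrable iKD => //; first by apply/measurable_EFinP; exact: measurable_ip.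
move=> w _; rewrite -EFinM !abse_EFin lee_fin.
apply: (le_trans (Cauchy_Schwarz hip _ _)); rewrite normrM normr_id.
by rewrite ler_wpM2r // (le_trans (UK w)) // ler_norm.
Qed.

Context {S : set (set T)}.
Hypothesis Sm : S `<=` measurable.

Lemma sub_H_rv (U : T -> H) : @H_rv R _ (g_sigma_algebraType S) H U -> H_rv U.
Proof. by move=> mU O oO; apply: sub_measurable; [exact: Sm|exact: mU]. Qed.

Variable D : T -> H.
Hypothesis mD : H_rv D.
Hypothesis iD : P.-integrable setT (fun w => (`|D w|)%:E).
Hypothesis D0 : forall G, <<s S >> G -> forall v, (\int[P]_(w in G) (ip v (D w))%:E = 0)%E.

(* [U] is within [e] of a countably valued [<<s S >>]-measurable variable, on whose level
   sets [D0] applies. *)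
Lemma integral_ip_ge0 (U : T -> H) (K : R) (G : set T) :
  @H_rv R _ (g_sigma_algebraType S) H U -> (forall w, `|U w| <= K) -> <<s S >> G ->
  (0 <= \int[P]_(w in G) (ip (U w) (D w))%:E)%E.
Proof.
move=> mU UK FG; have mU' := sub_H_rv _ mU; have mG : measurable G by exact: sub_measurable FG.
have iUD := integrable_ip _ _ _ mU' mD UK iD.
have iS (f : T -> R) E : measurable E -> P.-integrable setT (fun w => (f w)%:E) -> P.-integrable E (fun w => (f w)%:E).
  by move=> mE; apply: integrableS.
have [u hu] := separable_dense _ _ hsep.
have key (e : R) : 0 < e ->
    (0 <= e%:E * \int[P]_(w in G) (`|D w|)%:E + \int[P]_(w in G) (ip (U w) (D w))%:E)%E.
  move=> e0; pose F i := G `&` [set w | `|U w - u i| < e].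
  have FF i : <<s S >> (F i).
    have mE : measurable_fun setT ((fun w => (`|U w - u i|)%:E) : g_sigma_algebraType S -> \bar R).
      by apply/measurable_EFinP; apply: measurable_dist => //; exact: H_rv_cst.
    apply: (@measurableI _ (g_sigma_algebraType S)) => //.
    rewrite -[X in measurable X]setTI.
    exact: (@emeasurable_fun_infty_o _ (g_sigma_algebraType S) _ _ _ measurableT mE e%:E).
  have GE : G = \bigcup_i seqDU F i.
    rewrite -seqDU_bigcup_eq; apply/seteqP; split => [w Gw|w [i _ []]//].
    by have [i hi] := hu (U w) e e0; exists i.
  have FE i : <<s S >> (seqDU F i).
    rewrite /seqDU; apply: (@measurableD _ (g_sigma_algebraType S) (F i)); first exact: FF.
    by apply: (@bigsetU_measurable _ (g_sigma_algebraType S)) => j _; exact: FF.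
  have iDe E : measurable E -> P.-integrable E (fun w => e%:E * (`|D w|)%:E)%E.
    by move=> mE; apply: integrableZl => //; exact: iS.
  rewrite -integralZl //; last exact: iS.
  rewrite -integralD //; [|exact: iDe|exact: iS].
  rewrite [in X in (_ <= X)%E]GE integral_bigcup //; last 2 first.
  - by move=> i; apply: sub_measurable (FE i).
  - by rewrite -GE; apply: integrableD => //; [exact: iDe|exact: iS].
  apply: nneseries_ge0 => i _ _.
  have mE : measurable (seqDU F i) by apply: sub_measurable (FE i).
  have iuD : P.-integrable (seqDU F i) (fun w => (ip (u i) (D w))%:E).
    by apply: iS => //; apply: (integrable_ip (fun=> u i) _ `|u i|) => //; exact: H_rv_cst.
  (* On each piece [U] is compared with the constant [u i], whose pairing with [D] integrates to
     zero; the difference costs at most [e * |D w|]. *)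
  rewrite -[X in (_ <= X)%E]sube0 -[X in (_ <= _ - X)%E](D0 _ (FE i) (u i)) -integralB //; last first.
    by apply: integrableD => //; [exact: iDe|exact: iS].
  apply: integral_ge0 => w [[_ Uw] _].
  rewrite -EFinM -!EFinD lee_fin -addrA -(ipBl hip).
  have := ip_lower_bound hip (U w - u i) (D w); have := normr_ge0 (D w); rewrite /= in Uw.
  nra.
have fI : (\int[P]_(w in G) (`|D w|)%:E)%E \is a fin_num by apply: integrable_fin_num => //; exact: iS.
have fJ : (\int[P]_(w in G) (ip (U w) (D w))%:E)%E \is a fin_num by apply: integrable_fin_num => //; exact: iS.
have I0 : (0 <= \int[P]_(w in G) (`|D w|)%:E)%E by apply: integral_ge0 => w _; rewrite lee_fin.
move: key I0; rewrite -(fineK fI) -(fineK fJ); move: (fine _) (fine _) => J I key.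
rewrite !lee_fin => I0; rewrite leNgt; apply/negP => J0.
have I1 : 0 < I + 1 by rewrite ltr_wpDl.
(* This [e] makes [e * I <= - J / 2], so that [key] would give [0 <= J / 2]; the [+ 1] keeps the
   denominator positive when [I = 0]. *)
have := key (- J / (2 * (I + 1))).
rewrite -EFinM -EFinD lee_fin divr_gt0 ?mulr_gt0 ?oppr_gt0 // => /(_ isT).
have -> : - J / (2 * (I + 1)) * I = - J / 2 * (I / (I + 1)) by field; rewrite gt_eqF.
have : I / (I + 1) <= 1 by rewrite ler_pdivrMr // mul1r lerDl.
have : 0 <= I / (I + 1) by rewrite divr_ge0 // ltW.
nra.
Qed.

End Orthogonality.

(** * Integrating the pointwise energy inequality *)

Section IntegralStep.
Local Open Scope ereal_scope.
Context {R : realType} {d : measure_display} {T : measurableType d}.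
Variable P : probability T R.

(** If the integral of [N] is infinite, so is the right-hand side; otherwise all terms are
    integrable. The cross term [W] is dropped because its integral is nonnegative. *)
Lemma integral_step (G : set T) (V1 V2 W N : T -> R) (a c s : R) :
  measurable G -> P.-integrable G (EFin \o V1) -> P.-integrable G (EFin \o V2) ->
  P.-integrable G (EFin \o W) -> measurable_fun G N -> (forall w, (0 <= N w)%R) ->
  (0 <= c)%R -> (0 <= s)%R ->
  (forall w, (a * V1 w + c * W w <= V2 w + s + N w)%R) ->
  0 <= \int[P]_(w in G) (W w)%:E ->
  a%:E * \int[P]_(w in G) (V1 w)%:E <=
  \int[P]_(w in G) (V2 w)%:E + s%:E + \int[P]_(w in G) (N w)%:E.
Proof.
move=> mG iV1 iV2 iW mN N0 c0 s0 h W0.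
have mNE : measurable_fun G (EFin \o N) by exact/measurable_EFinP.
have fV2 : \int[P]_(w in G) (V2 w)%:E \is a fin_num by exact: integrable_fin_num.
have [Noo|Nfin] := eqVneq (\int[P]_(w in G) (N w)%:E) +oo.
  by rewrite Noo -(fineK fV2) -EFinD addey // leey.
have iN : P.-integrable G (EFin \o N).
  apply/integrableP; split => //.
  rewrite (eq_integral (fun w => (N w)%:E)); first by rewrite ltey.
  by move=> w _ /=; rewrite ger0_norm.
have is_ : P.-integrable G (cst s%:E) by exact: finite_measure_integrable_cst.
apply: (@le_trans _ _ (\int[P]_(w in G) (a%:E * (V1 w)%:E + c%:E * (W w)%:E))).
  rewrite integralD //; [|exact: integrableZl|exact: integrableZl].
  by rewrite !integralZl // leeDl // mule_ge0.
apply: (@le_trans _ _ (\int[P]_(w in G) ((V2 w)%:E + s%:E + (N w)%:E))).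
  apply: le_integral => //.
  - by apply: integrableD => //; exact: integrableZl.
  - by apply: integrableD => //; exact: integrableD.
  - by move=> w _; rewrite -!EFinM -!EFinD lee_fin.
rewrite integralD //; last exact: integrableD.
rewrite leeD2r // integralD // leeD2l // integral_cst //.
by rewrite -[leRHS]mule1 lee_wpmul2l // probability_le1.
Qed.

End IntegralStep.

(** * Integrability and centring of the conditional noise *)

Section ConditionalNoise.
Context {R : realType} {H : normedModType R} {ip : H -> H -> R}.
Hypothesis hip : is_inner_product ip.
Hypothesis hsep : separable H.
Context {d : measure_display} {T : measurableType d}.
Variable P : probability T R.
Context {S : set (set T)}.
Hypothesis Sm : S `<=` measurable.
Variables r Y Z : T -> H.
Hypothesis mr : H_rv r.
Hypothesis mY : H_rv Y.
Hypothesis rZ : is_cond_exp_H P ip <<s S>> r Z.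
Hypothesis ZY : {ae P, forall w, Z w = Y w}.

Let mZ : H_rv Z.
Proof. by case: rZ => mZ _ O oO; apply: sub_measurable; [exact: Sm|exact: mZ]. Qed.

Let iY : P.-integrable setT (fun w => (`|Y w|)%:E).
Proof.
have mYE : measurable_fun setT (fun w => (`|Y w|)%:E) by apply/measurable_EFinP; exact: measurable_norm.
have mZE : measurable_fun setT (fun w => (`|Z w|)%:E) by apply/measurable_EFinP; exact: measurable_norm.
case: rZ => _ [_ [/integrableP[_ iZ] _]]; apply/integrableP; split => //.
rewrite (ae_eq_integral (fun w => `|(`|Z w|)%:E|)%E) //; try exact: measurableT_comp.
by apply: filterS ZY => w /= -> _.
Qed.

Lemma integrable_noise : P.-integrable setT (fun w => (`|r w - Y w|)%:E).
Proof.
case: rZ => _ [ir _].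
have iD := integrableD measurableT ir iY.
apply: le_integrable iD => //.
  by apply/measurable_EFinP; exact: measurable_dist.
move=> w _; rewrite /= lee_fin normr_id; apply: (le_trans (ler_normB _ _)).
exact: ler_norm.
Qed.

(** The defining identity of the conditional expectation tested against [v], with [Y] exchanged for
    its version [Z]. *)
Lemma integral_noise G v : <<s S>> G -> (\int[P]_(w in G) (ip v (r w - Y w))%:E = 0)%E.
Proof.
move=> FG; have mG : measurable G by exact: sub_measurable FG.
have iv (U : T -> H) : H_rv U -> P.-integrable setT (fun w => (`|U w|)%:E) ->
    P.-integrable G (fun w => (ip v (U w))%:E).
  move=> mU iU; apply: (@integrableS _ _ _ _ setT) => //.
  by apply: (integrable_ip hip hsep P (fun=> v) U `|v|) => //; exact: H_rv_cst.
have [_ [ir [iZ hG]]] := rZ.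
under eq_integral do rewrite (ipBr hip) EFinB.
rewrite integralB //; [|exact: iv|exact: iv].
under eq_integral do rewrite (ipC hip); rewrite hG //.
rewrite (ae_eq_integral (fun w => (ip v (Y w))%:E) (fun w => (ip (Z w) v)%:E)) //.
- by apply: subee; apply: integrable_fin_num => //; exact: iv.
- by apply/measurable_EFinP; apply: measurable_funTS; apply: measurable_ip => //; exact: H_rv_cst.
- by apply/measurable_EFinP; apply: measurable_funTS; apply: measurable_ip => //; exact: H_rv_cst.
- by apply: filterS ZY => w /= -> _; rewrite (ipC hip).
Qed.

End ConditionalNoise.

(** * Nonnegative series shifted by two indices *)

Lemma nneseries_shift_lty (R : realType) (u : nat -> \bar R) : (forall n, 0 <= u n)%E ->
  (\sum_(n <oo) u n < +oo -> \sum_(n <oo) u n.+2 < +oo)%E.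
Proof.
move=> u0; apply: le_lt_trans; apply: lime_le; first exact: is_cvg_nneseries.
apply: nearW => N; apply: le_trans (nneseries_lim_ge N.+2 _) => //.
by rewrite [leRHS]big_nat_recl // big_nat_recl // addeA leeDr // adde_ge0.
Qed.

Lemma nneseries_unbounded (R : realType) (g : nat -> R) : (forall n, 0 <= g n) ->
  (\sum_(n <oo) (g n)%:E = +oo)%E ->
  forall M, exists N, M <= \sum_(k < N) g k.+2.
Proof.
move=> g0 goo M; apply: contrapT => nN.
suff : (\sum_(n <oo) (g n)%:E <= (g 0%N + g 1%N + M)%:E)%E by rewrite goo.
apply: lime_le; first by apply: is_cvg_nneseries => n _ _; rewrite lee_fin.
apply: nearW => N; rewrite big_mkord sumEFin lee_fin.
have : \sum_(k < N) g k.+2 <= M.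
  by rewrite leNgt; apply/negP => MN; apply: nN; exists N; exact: ltW.
have : \sum_(k < N) g k <= \sum_(k < N.+2) g k by rewrite !big_ord_recr /= -addrA lerDl addr_ge0.
have -> : \sum_(k < N.+2) g k = g 0%N + g 1%N + \sum_(k < N) g k.+2.
  by rewrite !big_ord_recl addrA.
lra.
Qed.

(** * The natural filtration of the iterates *)

Section NaturalFiltration.
Context {R : realType} {H : normedModType R} {d : measure_display} {T : measurableType d}.
Variable x : nat -> T -> H.

(** Generators of [natural_filtration x n], named apart so that the sigma-algebra they generate can
    serve as a measurable type. *)
Definition filtration_generators (n : nat) : set (set T) :=
  [set E | exists k, (k <= n)%N /\ exists O : set H, open O /\ E = x k @^-1` O].

Lemma filtration_generators_measurable n : (forall k, H_rv (x k)) ->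
  filtration_generators n `<=` measurable.
Proof. by move=> mx _ [k [_ [U [oU ->]]]]; exact: mx. Qed.

Lemma filtration_generators_mono n : filtration_generators n `<=` filtration_generators n.+1.
Proof. by move=> E [k [kn hk]]; exists k; split => //; exact: leqW. Qed.

Lemma adapted k n : (k <= n)%N -> @H_rv R _ (g_sigma_algebraType (filtration_generators n)) H (x k).
Proof. by move=> kn O oO; apply: sub_sigma_algebra; exists k; split => //; exists O. Qed.

End NaturalFiltration.

(** * Application to the reflected iteration *)

Section ReflectedForwardBackward.
Context {R : realType} {H : normedModType R} {ip : H -> H -> R}.
Hypotheses (hip : is_inner_product ip) (hsep : separable H).
Context {d : measure_display} {Omega : measurableType d} {P : probability Omega R}.
Context {A : H -> set H} {B : H -> H} {mu : R}.
Hypotheses (hA : monotone_op ip A) (hBmon : monotone_op ip (sv B)) (hmu : 0 < mu).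
Hypothesis hBlip : forall u v : H, `|B u - B v| <= mu * `|u - v|.
Hypothesis hunif : uniformly_monotone ip A \/ uniformly_monotone ip (sv B).
Context {xb : H} {K g0 : R}.
Hypotheses (hxb : zer A B xb) (K0 : 0 < K) (hK : forall y, dom A y -> `|y - xb| <= K).
Context {gamma : nat -> R}.
Hypothesis hgamma : forall n, 0 < gamma n <= g0.
Hypothesis hsq : (\sum_(n <oo) ((gamma n) ^+ 2)%:E < +oo)%E.
Hypothesis hdiv : (\sum_(n <oo) (gamma n)%:E = +oo)%E.
Context {x : nat -> Omega -> H} {xm1 : Omega -> H} {r : nat -> Omega -> H}.
Hypotheses (hx0 : H_rv (x 0%N)) (hxm1 : H_rv xm1) (hr : forall n, H_rv (r n)).
Hypothesis hcond : forall n, exists Z : Omega -> H,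
  is_cond_exp_H P ip (natural_filtration x n) (r n) Z /\
  {ae P, forall w, Z w = B (refl_iter x xm1 n w)}.
Hypothesis hiter : forall n w,
  resolvent_rel A (gamma n) (x n w - gamma n *: r n w) (x n.+1 w).
Context {e : nat -> Omega -> \bar R}.
Hypothesis he : forall n, is_cond_exp_nonneg P (natural_filtration x n)
  (fun w => (`|r n w - B (refl_iter x xm1 n w)| ^+ 2)%:E) (e n).
Hypothesis hnoise : {ae P, forall w, (\sum_(n <oo) ((gamma n) ^+ 2)%:E * e n w < +oo)%E}.

Let gamma_gt0 n : 0 < gamma n. Proof. by have /andP[] := hgamma n. Qed.

Let noise n w := r n w - B (refl_iter x xm1 n w).

Let S n := filtration_generators x n.

(** Nonexpansiveness of the resolvent carries measurability from the forward point to the next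
    iterate. *)
Lemma H_rv_iterate n : H_rv (x n).
Proof.
elim: n => // n ih.
apply: (H_rv_lipschitz (fun w => x n w - gamma n *: r n w)).
  by apply: H_rv_sub => //; apply: H_rv_scale.
move=> w w'; exact: (resolvent_nonexpansive hip (gamma n) _ _ _ _ hA (gamma_gt0 n) (hiter n w) (hiter n w')).
Qed.

Let Sm n : S n `<=` measurable.
Proof. exact: filtration_generators_measurable H_rv_iterate. Qed.

Let mBy n : H_rv (fun w => B (refl_iter x xm1 n w)).
Proof.
apply: (H_rv_lipschitz_comp B mu) => //; apply: H_rv_sub => //.
  by apply: H_rv_scale; exact: H_rv_iterate.
by case: n => // n; exact: H_rv_iterate.
Qed.

Let mnoise n : H_rv (noise n). Proof. exact: H_rv_sub. Qed.

Lemma iterate_bounded n w : `|x n.+1 w - xb| <= K.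
Proof. by apply: hK; have [a [Aa _]] := hiter n w; exists a. Qed.

Let inoise n : P.-integrable setT (fun w => (`|noise n w|)%:E).
Proof.
by have [Z [hZ ZB]] := hcond n; exact: (integrable_noise hsep P (Sm n) _ _ _ (hr n) (mBy n) hZ ZB).
Qed.

Let noise_ip_ge0 n (G : set Omega) : <<s S n.+1 >> G ->
  (0 <= \int[P]_(w in G) (ip (x n.+1 w - xb) (noise n.+1 w))%:E)%E.
Proof.
move=> FG; have [Z [hZ ZB]] := hcond n.+1.
apply: (integral_ip_ge0 hip hsep P (Sm n.+1) _ (mnoise _) (inoise _) _ _ K) => //.
- by move=> G' FG' v; exact: (integral_noise hip hsep P (Sm n.+1) _ _ _ (hr _) (mBy _) hZ ZB).
- by apply: H_rv_sub => //; [exact: adapted|exact: H_rv_cst].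
- exact: iterate_bounded.
Qed.

(** The shift by two makes both iterates outputs of the resolvent, hence within [K] of [xb], whereas
    [x 0] and [xm1] may be unbounded. *)
Let V n w := `|x n.+2 w - xb| ^+ 2 + `|x n.+2 w - x n.+1 w| ^+ 2 / 4.

(** The error terms of [energy_decrease] with the squared noise replaced by its conditional
    expectation [e n], which makes [b n] adapted. *)
Let b n w := (((8 * K ^+ 2 * mu ^+ 2) * gamma n ^+ 2)%:E + 4%:E * ((gamma n ^+ 2)%:E * e n w))%E.

Let V0 n w : 0 <= V n w.
Proof. by rewrite addr_ge0 ?divr_ge0 ?sqr_ge0. Qed.

Let VK n w : V n w <= 2 * K ^+ 2.
Proof.
have b1 := iterate_bounded n.+1 w; have b0 := iterate_bounded n w.
have b2 : `|x n.+2 w - x n.+1 w| <= 2 * K.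
  have -> : x n.+2 w - x n.+1 w = (x n.+2 w - xb) - (x n.+1 w - xb) by rewrite opprB addrC subrKA addrC.
  by rewrite (le_trans (ler_normB _ _)) // mulr_natl mulr2n lerD.
rewrite /V; move: (normr_ge0 (x n.+2 w - xb)) (normr_ge0 (x n.+2 w - x n.+1 w)); nra.
Qed.

Let FV n : measurable_fun setT (V n : g_sigma_algebraType (S n.+2) -> R).
Proof.
apply: measurable_funD.
  by apply: measurable_funX; apply: measurable_dist => //; [exact: adapted|exact: H_rv_cst].
apply: measurable_funM => //; apply: measurable_funX; apply: measurable_dist => //.
  exact: adapted.
exact: adapted.
Qed.

Let e0 n w : (0 <= e n w)%E. Proof. by case: (he n). Qed.

Let Fe n : measurable_fun setT (e n : g_sigma_algebraType (S n) -> \bar R).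
Proof. by move=> _ Y mY; rewrite setTI; have [_ [h _]] := he n; exact: h. Qed.

Let c0 n : 0 <= 8 * K ^+ 2 * mu ^+ 2 * gamma n ^+ 2.
Proof. by do 3?[apply: mulr_ge0; last exact: sqr_ge0]. Qed.

Let ge0 n w : (0 <= (gamma n ^+ 2)%:E * e n w)%E.
Proof. by rewrite mule_ge0 // lee_fin sqr_ge0. Qed.

Let b0 n w : (0 <= b n w)%E.
Proof. by apply: adde_ge0; [rewrite lee_fin c0|rewrite mule_ge0]. Qed.

Let Fb n : measurable_fun setT (b n : g_sigma_algebraType (S n) -> \bar R).
Proof.
apply: emeasurable_funD => //; apply: measurable_funeM; apply: measurable_funeM.
exact: Fe.
Qed.

(** On events of [<<s S n >>] the squared noise and [e n] have the same integral, by definition of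
    conditional expectation. *)
Let integral_bE n G : <<s S n >> G ->
  (\int[P]_(w in G) (8 * K ^+ 2 * mu ^+ 2 * gamma n ^+ 2 + 4 * gamma n ^+ 2 * `|noise n w| ^+ 2)%:E
   = \int[P]_(w in G) b n w)%E.
Proof.
move=> FG; have mG : measurable G by exact: (sub_measurable (Sm n) _ FG).
have me : measurable_fun G (e n).
  by apply: measurable_funTS; exact: (sub_measurable_fun (Sm n) _ _ _ (Fe n)).
have mN : measurable_fun G (fun w => (`|noise n w| ^+ 2)%:E).
  apply/measurable_EFinP; apply: measurable_funTS; apply: measurable_funX.
  exact: measurable_norm.
under eq_integral do rewrite EFinD -(mulrA 4) (EFinM 4) (EFinM (gamma n ^+ 2)).
have gN0 w : (0 <= (gamma n ^+ 2)%:E * (`|noise n w| ^+ 2)%:E)%E.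
  by rewrite mule_ge0 // lee_fin sqr_ge0.
rewrite ge0_integralD //; last 3 first.
- by move=> w _; rewrite lee_fin c0.
- by move=> w _; rewrite mule_ge0.
- by apply: measurable_funeM; apply: measurable_funeM.
rewrite [RHS]ge0_integralD //; last 3 first.
- by move=> w _; rewrite lee_fin c0.
- by move=> w _; rewrite mule_ge0.
- by apply: measurable_funeM; apply: measurable_funeM.
congr (_ + _)%E; rewrite ge0_integralZl //; last by apply: measurable_funeM.
rewrite [RHS]ge0_integralZl //; last by apply: measurable_funeM.
congr (_ * _)%E; have g20 : (0 <= (gamma n ^+ 2)%:E)%E by rewrite lee_fin sqr_ge0.
by have [_ [_ h]] := he n; rewrite !ge0_integralZl // h.
Qed.

Lemma energy_step (eps : R) : 0 < eps -> exists2 eta : R, 0 < eta &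
  forall n G, <<s S n.+2 >> G ->
  ((1 + gamma n.+2 * eta)%:E * \int[P]_(w in G) (V n.+1 w)%:E <=
  \int[P]_(w in G) (V n w)%:E + (gamma n.+2 * eta * eps)%:E + \int[P]_(w in G) b n.+2 w)%E.
Proof.
move=> eps0.
have g00 : 0 < g0 by have /andP[h1 h2] := hgamma 0; exact: lt_le_trans h2.
have [eta eta0 heta] := energy_decrease hip hA hBmon hmu hBlip hunif xb K g0 hxb K0 g00 _ eps0.
exists eta => // n G FG.
have mG : measurable G by exact: (sub_measurable (Sm _) _ FG).
have mV k : measurable_fun setT (V k) by exact: (sub_measurable_fun (Sm _) _ _ _ (FV k)).
have iV k : P.-integrable G (EFin \o V k).
  apply: measurable_bounded_integrable => //; first by apply: le_lt_trans (probability_le1 P mG) (ltry _).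
    exact: measurable_funTS.
  exists (2 * K ^+ 2); split => [|M hM w _]; first by rewrite num_real.
  by rewrite /= ger0_norm // (le_trans (VK k w)) // ltW.
rewrite -integral_bE //.
(* [W] is the cross term of [energy_decrease]; its integral over [G] is nonnegative by
   [noise_ip_ge0]. *)
apply: (@integral_step _ _ _ _ _ _ _ (fun w => ip (x n.+2 w - xb) (noise n.+2 w)) _ _ (2 * gamma n.+2)) => //.
- apply: (@integrableS _ _ _ _ setT) => //.
  apply: (integrable_ip hip hsep P _ _ K) => //; last exact: iterate_bounded.
  by apply: H_rv_sub => //; [exact: H_rv_iterate|exact: H_rv_cst].
- apply: measurable_funTS; apply: measurable_funD => //; apply: measurable_funM => //.
  by apply: measurable_funX; apply: measurable_norm.
- by move=> w; rewrite addr_ge0 ?c0 // mulr_ge0 ?sqr_ge0 // mulr_ge0 ?sqr_ge0.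
- by rewrite mulr_ge0 // ltW.
- by rewrite !mulr_ge0 // ltW.
- move=> w; have := heta _ (x n.+1 w) (x n.+2 w) (x n.+3 w) (r n.+2 w) (hgamma n.+2)
    (iterate_bounded _ _) (hiter _ _) (noise n.+2 w) erefl.
  rewrite /V; lra.
- exact: noise_ip_ge0.
Qed.

Lemma noise_summable : {ae P, forall w, (\sum_(n <oo) b n w < +oo)%E}.
Proof.
apply: filterS hnoise => w hw.
rewrite nneseriesD; last 2 first.
- by move=> i _ _; rewrite lee_fin c0.
- by move=> i _ _; rewrite mule_ge0.
under eq_eseriesr do rewrite EFinM.
rewrite nneseriesZl; last by move=> i _; rewrite lee_fin sqr_ge0.
rewrite nneseriesZl //.
rewrite lte_add_pinfty // lte_mul_pinfty // lee_fin.
by do 2?[apply: mulr_ge0; last exact: sqr_ge0].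
Qed.

Theorem reflected_forward_backward_cvg : {ae P, forall w, (fun n => x n w) @ \oo --> xb}.
Proof.
have gdiv := nneseries_unbounded _ gamma (fun n => ltW (gamma_gt0 n)) hdiv.
have bfin : {ae P, forall w, (\sum_(n <oo) b n.+2 w < +oo)%E}.
  by apply: filterS noise_summable => w; exact: nneseries_shift_lty.
have := almost_supermartingale_cvg0 P (fun n => S n.+2) (fun n => Sm n.+2)
  (fun n => filtration_generators_mono x n.+2) V (fun n => b n.+2) (fun n => gamma n.+2)
  (2 * K ^+ 2) V0 VK FV (fun n => b0 n.+2) (fun n => Fb n.+2)
  (fun n => ltW (gamma_gt0 n.+2)) gdiv energy_step bfin.
apply: filterS => w /cvgr0Pnorm_lt hV; apply/cvgrPdist_lt => eps eps0.
have [N _ hN] := hV _ (exprn_gt0 2 eps0).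
(* [V n] controls [x n.+2], hence the shift of the rank. *)
exists N.+2 => // -[|[|n]] //= Nn; have := hN n Nn.
rewrite ger0_norm // distrC => hn; rewrite -ltr_sqr ?nnegrE ?(ltW eps0) //.
by apply: le_lt_trans hn; rewrite lerDl divr_ge0 // sqr_ge0.
Qed.

End ReflectedForwardBackward.

Theorem mainTheorem5
  (R : realType) (H : completeNormedModType R) (ip : H -> H -> R)
  (hip : is_inner_product ip) (hsep : separable H)
  (d : measure_display) (Omega : measurableType d) (P : probability Omega R)
  (A : H -> set H) (B : H -> H) (mu : R)
  (hA : maximally_monotone ip A)
  (hBmon : monotone_op ip (sv B))
  (hmu : 0 < mu)
  (hBlip : forall u v : H, `|B u - B v| <= mu * `|u - v|)
  (hzer : zer A B !=set0)
  (hdom : norm_bounded (dom A))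
  (hunif : uniformly_monotone ip A \/ uniformly_monotone ip (sv B))
  (gamma : nat -> R)
  (hgamma : forall n, 0 < gamma n < (Num.sqrt 2 - 1) / mu)
  (hdecr : forall n, gamma n.+1 <= gamma n)
  (hsq : (\sum_(n <oo) ((gamma n) ^+ 2)%:E < +oo)%E)
  (hdiv : (\sum_(n <oo) (gamma n)%:E = +oo)%E)
  (x : nat -> Omega -> H) (xm1 : Omega -> H) (r : nat -> Omega -> H)
  (hx0 : square_integrable P (x 0%N))
  (hxm1 : square_integrable P xm1)
  (hr : forall n, H_rv (r n))
  (hcond : forall n, exists Z : Omega -> H,
      is_cond_exp_H P ip (natural_filtration x n) (r n) Z /\
      {ae P, forall w, Z w = B (refl_iter x xm1 n w)})
  (hiter : forall n w,
      resolvent_rel A (gamma n) (x n w - gamma n *: r n w) (x n.+1 w))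
  (hnoise : exists e : nat -> Omega -> \bar R,
      (forall n, is_cond_exp_nonneg P (natural_filtration x n)
         (fun w => (`|r n w - B (refl_iter x xm1 n w)| ^+ 2)%:E) (e n)) /\
      {ae P, forall w, (\sum_(n <oo) ((gamma n) ^+ 2)%:E * e n w < +oo)%E}) :
  exists xbar : H, zer A B = [set xbar] /\
    {ae P, forall w, (fun n => x n w) @ \oo --> xbar}.
Proof.
have [xb hxb] := hzer; have [mA _] := hA.
exists xb; split.
  by apply/seteqP; split => [y hy|_ ->] //; exact: (zer_unique hip mA hBmon hunif).
have [M hM] := hdom; have [e [he hse]] := hnoise.
have [hx0' _] := hx0; have [hxm1' _] := hxm1.
(* The radius bounds [|y - xb|] on [dom A] by the triangle inequality, with [+ 1] for strict
   positivity; [gamma 0] dominates all step sizes since they decrease. *)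
apply: (@reflected_forward_backward_cvg _ _ _ hip hsep _ _ _ A B mu mA hBmon hmu hBlip hunif xb
  (`|M| + `|xb| + 1) (gamma 0%N) hxb _ _ gamma _ hsq hdiv x xm1 r hx0' hxm1' hr hcond hiter e he hse).
- by rewrite ltr_wpDl // addr_ge0.
- move=> y hy; rewrite (le_trans (ler_normB _ _)) // -addrA lerD //.
    by rewrite (le_trans (hM _ hy)) // ler_norm.
  by rewrite lerDl.
- move=> n; have /andP[-> _] := hgamma n; elim: n => //= n ih; exact: le_trans (hdecr n) ih.
Qed.
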